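(* Let $M$ be a smooth connected manifold with a linear connection $\nabla$ (a connection on $TM$) with torsion $T$ and curvature $\mathfrak{R}$. For $\theta\in\bigwedge^1(M)$ and $X,Y,Z,W\in\mathfrak{X}(M)$, $$\theta(d^\nabla T(X,Y,Z))=\mathfrak{R}_\theta(X,Y,Z)+d(T_\theta-\Xi_\theta)(X,Y,Z),$$ $$\theta\big((d^\nabla\mathfrak{R}(X,Y,Z))W\big)=d(\mathfrak{R}_{\theta,W}-\Psi_{\theta,W})(X,Y,Z).$$ Hence the identity $d^\nabla T=\mathfrak{R}\wedge I$ is equivalent to the statement that $dT_\theta=d\Xi_\theta=\mathfrak{R}_\theta+\nabla\theta\wedge T$ for all $\theta$, and the identity $d^\nabla\mathfrak{R}=0$ is equivalent to the statement that $d\mathfrak{R}_{\theta,W}=d\Psi_{\theta,W}=\nabla\theta\wedge\mathfrak{R}_W+\mathfrak{R}_\theta\wedge\nabla W$ for all $\theta$ and $W$; and so $d^\nabla T=\mathfrak{R}\wedge I$ and $d^\nabla\mathfrak{R}=0$ follow by taking exterior derivatives of the structure equations $T_\theta=d\theta+\Xi_\theta$ and $\mathfrak{R}_{\theta,W}=d\omega_{\theta,W}+\Psi_{\theta,W}$.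
   Context: $\mathfrak{X}(M)$ denotes smooth vector fields on $M$. Torsion and curvature: $T(X,Y)=\nabla_XY-\nabla_YX-[X,Y]$, $\mathfrak{R}(X,Y)Z=\nabla_X\nabla_YZ-\nabla_Y\nabla_XZ-\nabla_{[X,Y]}Z$; $T$ is regarded as a vector-valued $2$-form and $\mathfrak{R}$ as an endomorphism-valued $2$-form. The exterior covariant derivative $d^\nabla$ of a tensor-valued $k$-form $A$ ($k\ge1$) is $$d^\nabla A(X_0,\dots,X_k)=\sum_{i=0}^k(-1)^i\nabla_{X_i}(A(X_0,\dots,\bar X_i,\dots,X_k))+\sum_{0\le i<j\le k}(-1)^{i+j}A([X_i,X_j],X_0,\dots,\bar X_i,\dots,\bar X_j,\dots,X_k),$$ where a bar means the argument is omitted, and $\nabla$ acts on endomorphisms by $(\nabla_XE)W=\nabla_X(EW)-E\nabla_XW$. The connection acts on $1$-forms by $(\nabla_X\theta)(Y)=X(\theta(Y))-\theta(\nabla_XY)$. $I$ is the identity endomorphism of $\mathfrak{X}(M)$ and $(\mathfrak{R}\wedge I)(X,Y,Z)=\sum_{\mathrm{cyclic}\ XYZ}\mathfrak{R}(X,Y)Z$, where $\sum_{\mathrm{cyclic}\ XYZ}$ is the sum over the three cyclic permutations of $(X,Y,Z)$. The ordinary forms are: $T_\theta(X,Y)=\theta(T(X,Y))$; $\Xi_\theta(X,Y)=(\nabla_Y\theta)(X)-(\nabla_X\theta)(Y)$; $\mathfrak{R}_{\theta,W}(X,Y)=\theta(\mathfrak{R}(X,Y)W)$; $\omega_{\theta,W}(X)=\theta(\nabla_XW)$;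 $\Psi_{\theta,W}(X,Y)=(\nabla_Y\theta)(\nabla_XW)-(\nabla_X\theta)(\nabla_YW)$; $\mathfrak{R}_\theta(X,Y,Z)=\sum_{\mathrm{cyclic}\ XYZ}\theta(\mathfrak{R}(X,Y)Z)$; $(\nabla\theta\wedge T)(X,Y,Z)=\sum_{\mathrm{cyclic}\ XYZ}(\nabla_X\theta)(T(Y,Z))$; $(\nabla\theta\wedge\mathfrak{R}_W)(X,Y,Z)=\sum_{\mathrm{cyclic}\ XYZ}(\nabla_X\theta)(\mathfrak{R}(Y,Z)W)$; $(\mathfrak{R}_\theta\wedge\nabla W)(X,Y,Z)=\sum_{\mathrm{cyclic}\ XYZ}\theta(\mathfrak{R}(Y,Z)\nabla_XW)$. The exterior derivative is normalized by $d\theta(X,Y)=X(\theta(Y))-Y(\theta(X))-\theta([X,Y])$ on $1$-forms and $d\beta(X,Y,Z)=\sum_{\mathrm{cyclic}\ XYZ}\big(X(\beta(Y,Z))-\beta([X,Y],Z)\big)$ on $2$-forms. *)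

(* Defs.v *)
From HB Require Import structures.
From mathcomp Require Import all_boot all_order all_algebra.
From mathcomp Require Import all_classical all_reals topology normedtype derive.
From mathcomp Require Import ring.

Set Implicit Arguments.
Unset Strict Implicit.
Unset Printing Implicit Defensive.
Import Order.TTheory GRing.Theory Num.Theory.
Import numFieldNormedType.Exports.
Local Open Scope classical_set_scope.
Local Open Scope ring_scope.

Section Smooth.
Variables (R : realType) (V W : normedModType R).

(* Meant for U open: f has arbitrary values outside U, and neither derivable nor
   'D_v f at a point of U depends on them. *)
Fixpoint is_Ck (k : nat) (U : set V) (f : V -> W) : Prop :=
  (forall x, U x -> {for x, continuous f}) /\
  (if k is k'.+1 then
     forall v, (forall x, U x -> derivable f x v) /\
               is_Ck k' U (fun x => 'D_v f x)
   else True).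

Definition smooth_on (U : set V) (f : V -> W) : Prop :=
  forall k, is_Ck k U f.

End Smooth.

Section SmoothTheory.
Variables (R : realType) (V : normedModType R).
Implicit Types (U : set V).

Lemma is_Ck_cont (W : normedModType R) k U (f : V -> W) :
  is_Ck k U f -> forall x, U x -> {for x, continuous f}.
Proof. by case: k => [|k] []. Qed.

Lemma is_CkS (W : normedModType R) k U (f : V -> W) :
  is_Ck k.+1 U f -> is_Ck k U f.
Proof.
elim: k f => [|k IH] f; first by case.
move=> [fc fd]; split=> // v; have [dv Cv] := fd v; split=> //; exact: IH.
Qed.

Lemma eq_is_Ck (W : normedModType R) k U (f g : V -> W) : open U ->
  (forall x, U x -> f x = g x) -> is_Ck k U f -> is_Ck k U g.
Proof.
move=> oU; elim: k f g => [|k IH] f g fg Cf.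
all: have nfg x : U x -> \forall y \near x, f y = g y by
  move=> Ux; have : \forall y \near x, U y by [exact: open_nbhs_nbhs];
  apply: filterS => y Uy; rewrite fg.
all: have gc x : U x -> {for x, continuous g} by
  move=> Ux; have := is_Ck_cont Cf Ux; rewrite /prop_for /continuous_at (fg _ Ux);
  apply: cvg_trans; apply: near_eq_cvg; exact: nfg.
  by split.
split=> // v; have [dv Cv] := Cf.2 v; split.
  by move=> x Ux; apply: near_eq_derivable (dv x Ux); exact: nfg.
by apply: IH Cv => x Ux; apply: near_eq_derive; exact: nfg.
Qed.

Lemma is_Ck_cst (W : normedModType R) k U (a : W) : is_Ck k U (cst a).
Proof.
elim: k a => [|k IH] a; first by split=> // x _; exact: cvg_cst.
split=> [x _|v]; first exact: cvg_cst.
split=> [x _|]; first exact: derivable_cst.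
rewrite [X in is_Ck _ _ X](_ : _ = cst 0); first exact: IH.
by apply/funext => x; rewrite derive_cst.
Qed.

Lemma is_CkD (W : normedModType R) k U (f g : V -> W) : open U ->
  is_Ck k U f -> is_Ck k U g -> is_Ck k U (f + g).
Proof.
move=> oU; elim: k f g => [|k IH] f g Cf Cg.
all: have Cfg x : U x -> {for x, continuous (f + g)} by
  move=> Ux; apply: continuousD; [exact: (is_Ck_cont Cf Ux)|exact: (is_Ck_cont Cg Ux)].
  by split.
split=> // v; have [df Df] := Cf.2 v; have [dg Dg] := Cg.2 v; split.
  by move=> x Ux; apply: derivableD; [exact: df|exact: dg].
apply: eq_is_Ck (IH _ _ Df Dg) => // x Ux.
by rewrite deriveD; [|exact: df|exact: dg].
Qed.

Lemma is_CkZ (W : normedModType R) k U (a : R) (f : V -> W) : open U ->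
  is_Ck k U f -> is_Ck k U (a *: f).
Proof.
move=> oU; elim: k f => [|k IH] f Cf.
all: have Caf x : U x -> {for x, continuous (a *: f)} by
  move=> Ux; exact: (continuousZl_tmp (k := a) (is_Ck_cont Cf Ux)).
  by split.
split=> // v; have [df Df] := Cf.2 v; split.
  by move=> x Ux; apply: derivableZ; exact: df.
apply: eq_is_Ck (IH _ Df) => // x Ux.
by rewrite deriveZ; [|exact: df].
Qed.

Lemma is_CkM k U (f g : V -> R^o) : open U ->
  is_Ck k U f -> is_Ck k U g -> is_Ck k U (f * g).
Proof.
move=> oU; elim: k f g => [|k IH] f g Cf Cg.
all: have Cfg x : U x -> {for x, continuous (f * g)} by
  move=> Ux; apply: cvgM; [exact: (is_Ck_cont Cf Ux)|exact: (is_Ck_cont Cg Ux)].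
  by split.
split=> // v; have [df Df] := Cf.2 v; have [dg Dg] := Cg.2 v; split.
  by move=> x Ux; apply: derivableM; [exact: df|exact: dg].
apply: eq_is_Ck (is_CkD oU (IH _ _ (is_CkS Cf) Dg) (IH _ _ (is_CkS Cg) Df)) => //.
by move=> x Ux; rewrite deriveM; [|exact: df|exact: dg].
Qed.

End SmoothTheory.

(* coord and param are total functions, only meaningful on dom and coord @` dom. *)
Record chart (R : realType) (n : nat) (M : topologicalType) := Chart {
  dom : set M;
  coord : M -> 'rV[R]_n;
  param : 'rV[R]_n -> M;
  dom_open : open dom;
  img_open : open (coord @` dom);
  coordK : forall p, dom p -> param (coord p) = p;
  coord_cont : forall p, dom p -> {for p, continuous coord};
  param_cont : forall x, (coord @` dom) x -> {for x, continuous param} }.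

Record smoothManifold (R : realType) (n : nat) := SmoothManifold {
  carrier :> topologicalType;
  atlas : set (chart R n carrier);
  atlas_cover : forall p, exists2 c, atlas c & dom c p;
  atlas_compat : forall c c', atlas c -> atlas c' ->
    smooth_on (coord c @` (dom c `&` dom c')) (coord c' \o param c);
  manifold_hausdorff : hausdorff_space carrier;
  manifold_second_countable : @second_countable carrier }.

Section Cinf.
Context {R : realType} {n : nat} (M : smoothManifold R n).

Definition smooth_fun : {pred M -> R^o} := fun f =>
  `[< forall c, atlas c -> smooth_on (coord c @` dom c) (f \o param c) >].

Lemma smooth_funP (f : M -> R^o) : reflect
  (forall c, atlas c -> smooth_on (coord c @` dom c) (f \o param c))
  (f \in smooth_fun).
Proof. exact: asboolP. Qed.

Lemma smooth_fun_submod_closed : submod_closed smooth_fun.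
Proof.
split=> [|a f g /smooth_funP Cf /smooth_funP Cg]; apply/smooth_funP => c Ac k.
  exact: is_Ck_cst.
apply: is_CkD; [exact: img_open| |exact: Cg].
by apply: is_CkZ; [exact: img_open|exact: Cf].
Qed.

Lemma smooth_fun_subring_closed : subring_closed smooth_fun.
Proof.
split=> [|f g|f g /smooth_funP Cf /smooth_funP Cg].
- by apply/smooth_funP => c Ac k; exact: is_Ck_cst.
- exact: (GRing.submod_closedB smooth_fun_submod_closed).2.
by apply/smooth_funP => c Ac k; apply: is_CkM; [exact: img_open|exact: Cf|exact: Cg].
Qed.

Record Cinf := MkCinf { Cinf_fun :> M -> R^o; Cinf_smooth : Cinf_fun \in smooth_fun }.

HB.instance Definition _ := [isSub of Cinf for Cinf_fun].
HB.instance Definition _ := [Choice of Cinf by <:].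
HB.instance Definition _ :=
  GRing.SubChoice_isSubComPzRing.Build _ _ Cinf smooth_fun_subring_closed.
HB.instance Definition _ :=
  GRing.SubZmodule_isSubLmodule.Build R _ _ Cinf smooth_fun_submod_closed.

Lemma CinfP (f g : Cinf) : (forall p, f p = g p) -> f = g.
Proof. by move=> fg; apply/val_inj/funext. Qed.

Lemma CinfDE (f g : Cinf) p : (f + g) p = f p + g p. Proof. by []. Qed.
Lemma CinfNE (f : Cinf) p : (- f) p = - f p. Proof. by []. Qed.
Lemma CinfME (f g : Cinf) p : (f * g) p = f p * g p. Proof. by []. Qed.
Lemma CinfZE a (f : Cinf) p : (a *: f) p = a * f p. Proof. by []. Qed.

End Cinf.

Arguments smooth_fun {R n} M.

(* T_p M is the space of derivations at p of the algebra of smooth functions. *)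
Section Tangent.
Context {R : realType} {n : nat} (M : smoothManifold R n) (p : M).

Definition derivation_at : {pred Cinf M -> R^o} := fun v =>
  `[< (forall a f g, v (a *: f + g) = a * v f + v g) /\
      (forall f g, v (f * g) = v f * g p + f p * v g) >].

Lemma derivation_at_submod_closed : submod_closed derivation_at.
Proof.
split=> [|a u v /asboolP[uL uM] /asboolP[vL vM]]; apply/asboolP; split=> [b f g|f g].
- by rewrite /= mulr0 addr0.
- by rewrite /= mul0r mulr0 addr0.
- change (a * u (b *: f + g) + v (b *: f + g) =
          b * (a * u f + v f) + (a * u g + v g)).
  by rewrite uL vL !mulrDr addrACA mulrCA.
- change (a * u (f * g) + v (f * g) =
          (a * u f + v f) * g p + f p * (a * u g + v g)).
  by rewrite uM vM !mulrDr mulrDl addrACA mulrA (mulrCA (f p)).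
Qed.

Record tangent := MkTangent { tangent_fun :> Cinf M -> R^o;
                              tangentP : tangent_fun \in derivation_at }.

HB.instance Definition _ := [isSub of tangent for tangent_fun].
HB.instance Definition _ := [Choice of tangent by <:].
HB.instance Definition _ := GRing.SubChoice_isSubLmodule.Build R _ _ tangent
  derivation_at_submod_closed.

Lemma tangent_inj (u v : tangent) : (forall f, u f = v f) -> u = v.
Proof. by move=> uv; apply/val_inj/funext. Qed.

Lemma tangentL (v : tangent) a f g : v (a *: f + g) = a * v f + v g.
Proof. by have /asboolP[] := tangentP v. Qed.

Lemma tangentM (v : tangent) f g : v (f * g) = v f * g p + f p * v g.
Proof. by have /asboolP[] := tangentP v. Qed.

Lemma tangentB (v : tangent) f g : v (f - g) = v f - v g.
Proof.
have -> : f - g = (-1) *: g + f by rewrite scaleN1r addrC.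
by rewrite tangentL mulN1r addrC.
Qed.

End Tangent.

Section VectorField.
Context {R : realType} {n : nat} (M : smoothManifold R n).

Record vfield := MkVfield {
  vfield_at :> forall p : M, tangent p;
  vfield_smooth : forall f : Cinf M, (fun p => vfield_at p f) \in smooth_fun M }.

Definition vact (X : vfield) (f : Cinf M) : Cinf M := MkCinf (vfield_smooth X f).

Lemma vfieldP (X Y : vfield) : (forall p f, X p f = Y p f) -> X = Y.
Proof.
case: X Y => [X sX] [Y sY] /= XY.
have E : X = Y by apply/functional_extensionality_dep => p; exact/tangent_inj/XY.
by subst Y; congr MkVfield; exact: Prop_irrelevance.
Qed.

HB.instance Definition _ := gen_eqMixin vfield.
HB.instance Definition _ := gen_choiceMixin vfield.

Program Definition vfield0 := @MkVfield (fun p => 0) _.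
Next Obligation. by move=> f; exact: (Cinf_smooth (0 : Cinf M)). Qed.

Program Definition vfield_opp (X : vfield) := @MkVfield (fun p => - X p) _.
Next Obligation. by move=> X f; exact: (Cinf_smooth (- vact X f)). Qed.

Program Definition vfield_add (X Y : vfield) := @MkVfield (fun p => X p + Y p) _.
Next Obligation. by move=> X Y f; exact: (Cinf_smooth (vact X f + vact Y f)). Qed.

Program Definition vfield_scale (h : Cinf M) (X : vfield) :=
  @MkVfield (fun p => h p *: X p) _.
Next Obligation. by move=> h X f; exact: (Cinf_smooth (h * vact X f)). Qed.

Lemma vfield_addA : associative vfield_add.
Proof. by move=> X Y Z; apply: vfieldP => p f /=; rewrite addrA. Qed.
Lemma vfield_addC : commutative vfield_add.
Proof. by move=> X Y; apply: vfieldP => p f /=; rewrite addrC. Qed.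
Lemma vfield_add0 : left_id vfield0 vfield_add.
Proof. by move=> X; apply: vfieldP => p f /=; rewrite add0r. Qed.
Lemma vfield_addN : left_inverse vfield0 vfield_opp vfield_add.
Proof. by move=> X; apply: vfieldP => p f /=; rewrite addNr. Qed.

HB.instance Definition _ := GRing.isZmodule.Build vfield
  vfield_addA vfield_addC vfield_add0 vfield_addN.

Lemma vfield_scaleA g h X :
  vfield_scale g (vfield_scale h X) = vfield_scale (g * h) X.
Proof. by apply: vfieldP => p f /=; rewrite scalerA. Qed.
Lemma vfield_scale1 : left_id 1 vfield_scale.
Proof. by move=> X; apply: vfieldP => p f /=; rewrite scale1r. Qed.
Lemma vfield_scaleDr : right_distributive vfield_scale +%R.
Proof. by move=> h X Y; apply: vfieldP => p f /=; rewrite scalerDr. Qed.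
Lemma vfield_scaleDl X : {morph vfield_scale^~ X : g h / g + h}.
Proof. by move=> g h; apply: vfieldP => p f /=; rewrite scalerDl. Qed.

HB.instance Definition _ := GRing.Zmodule_isLmodule.Build (Cinf M) vfield
  vfield_scaleA vfield_scale1 vfield_scaleDr vfield_scaleDl.

Lemma vfieldDE (X Y : vfield) p f : (X + Y) p f = X p f + Y p f.
Proof. by []. Qed.
Lemma vfieldNE (X : vfield) p f : (- X) p f = - X p f. Proof. by []. Qed.
Lemma vfieldZE h (X : vfield) p f : (h *: X) p f = h p * X p f.
Proof. by []. Qed.

Lemma bracket_subproof (X Y : vfield) (p : M) :
  (fun f => X p (vact Y f) - Y p (vact X f)) \in derivation_at p.
Proof.
have actL Z a f g : vact Z (a *: f + g) = a *: vact Z f + vact Z g.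
  by apply: CinfP => q; exact: tangentL.
have actM Z f g : vact Z (f * g) = g * vact Z f + f * vact Z g.
  by apply: CinfP => q; rewrite /= tangentM mulrC.
apply/asboolP; split=> [a f g|f g].
  by rewrite !actL !tangentL; ring.
rewrite !actM; have D u h k : (u : tangent p) (h + k) = u h + u k.
  by rewrite -[h in LHS]scale1r tangentL mul1r.
by rewrite !D !tangentM /=; ring.
Qed.

Program Definition bracket (X Y : vfield) : vfield :=
  @MkVfield (fun p => MkTangent (bracket_subproof X Y p)) _.
Next Obligation. by move=> X Y f; exact: (Cinf_smooth (vact X (vact Y f) - vact Y (vact X f))). Qed.

Definition linear_endo : {pred vfield -> vfield} := fun E =>
  `[< forall h X Y, E (h *: X + Y) = h *: E X + E Y >].

Lemma linear_endo_submod_closed : submod_closed linear_endo.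
Proof.
split=> [|a E F /asboolP EL /asboolP FL]; apply/asboolP => h X Y.
  by rewrite /= scaler0 addr0.
change (a *: E (h *: X + Y) + F (h *: X + Y) =
        h *: (a *: E X + F X) + (a *: E Y + F Y)).
by rewrite EL FL !scalerDr addrACA !scalerA (mulrC a).
Qed.

Record endo := MkEndo { endo_fun :> vfield -> vfield;
                        endoP : endo_fun \in linear_endo }.

HB.instance Definition _ := [isSub of endo for endo_fun].
HB.instance Definition _ := [Choice of endo by <:].
HB.instance Definition _ := GRing.SubChoice_isSubLmodule.Build (Cinf M) _ _ endo
  linear_endo_submod_closed.

Lemma endoL (E : endo) h X Y : E (h *: X + Y) = h *: E X + E Y.
Proof. by have /asboolP := endoP E. Qed.

Lemma endoD (E : endo) X Y : E (X + Y) = E X + E Y.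
Proof. by rewrite -[X in LHS]scale1r endoL scale1r. Qed.

Lemma endoZ (E : endo) h X : E (h *: X) = h *: E X.
Proof.
have E0 : E 0 = 0 by apply: (addrI (E 0)); rewrite -endoD !addr0.
by rewrite -[h *: X in LHS]addr0 endoL E0 addr0.
Qed.

Lemma endo_inj (E F : endo) : (forall X, E X = F X) -> E = F.
Proof. by move=> EF; apply/val_inj/funext. Qed.

(* A one-form is a covector field p |-> theta_p in (T_p M)^*, smooth in the
   sense that it maps smooth vector fields to smooth functions. *)
Record oneform := MkOneform {
  oneform_at : forall p : M, {linear tangent p -> R^o};
  oneform_smooth : forall X : vfield,
    (fun p => oneform_at p (X p)) \in smooth_fun M }.

Definition oneform_eval (theta : oneform) (X : vfield) : Cinf M :=
  MkCinf (oneform_smooth theta X).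

End VectorField.

Coercion oneform_eval : oneform >-> Funclass.

Arguments linear_endo {R n} M.
Arguments bracket {R n M} X Y.
Arguments vact {R n M} X f.

Record connection (R : realType) (n : nat) (M : smoothManifold R n) := Connection {
  nabla :> vfield M -> vfield M -> vfield M;
  nabla_linearl : forall (f : Cinf M) X X' Y,
    nabla (f *: X + X') Y = f *: nabla X Y + nabla X' Y;
  nabla_addr : forall X Y Y', nabla X (Y + Y') = nabla X Y + nabla X Y';
  nabla_leibniz : forall X (f : Cinf M) Y,
    nabla X (f *: Y) = vact X f *: Y + f *: nabla X Y }.

Section Forms.
Context {R : realType} {n : nat} {M : smoothManifold R n}.
Local Notation VF := (vfield M).
Local Notation C := (Cinf M).

(* A form is given by its values on vector fields; alternation and
   C^oo-multilinearity are not part of the type. *)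
Definition form1 (E : Type) := VF -> E.
Definition form2 (E : Type) := VF -> VF -> E.
Definition form3 (E : Type) := VF -> VF -> VF -> E.

Definition cyclic (E : zmodType) (F : form3 E) : form3 E :=
  fun X Y Z => F X Y Z + F Y Z X + F Z X Y.

Definition ext_d1 (theta : form1 C) : form2 C := fun X Y =>
  vact X (theta Y) - vact Y (theta X) - theta (bracket X Y).

Definition ext_d2 (beta : form2 C) : form3 C :=
  cyclic (fun X Y Z => vact X (beta Y Z) - beta (bracket X Y) Z).

(* The exterior covariant derivative of the (k+1)-form A with values in E, where
   act X is the covariant derivative along X on E.  In the second sum the pair
   i < j of indices of X_0, ..., X_{k+1} is given by j : 'I_k.+2 and i : 'I_k.+1
   with i < j, so that i and lift j i have the same value, and
   m |-> lift j (lift i m) enumerates the indices other than i and j. *)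
Definition ext_dnabla (E : zmodType) (act : VF -> E -> E) (k : nat)
    (A : ('I_k.+1 -> VF) -> E) (X : 'I_k.+2 -> VF) : E :=
  \sum_(i < k.+2) act (X i) (A (fun m => X (lift i m))) *~ (-1) ^+ i +
  \sum_(j < k.+2) \sum_(i < k.+1 | (i < j)%N)
    A (fun m => if unlift ord0 m is Some m' then X (lift j (lift i m'))
                else bracket (X (lift j i)) (X j)) *~ (-1) ^+ (i + j).

Definition ext_dnabla2 (E : zmodType) (act : VF -> E -> E) (A : form2 E) : form3 E :=
  fun X Y Z => @ext_dnabla E act 1 (fun v => A (v ord0) (v ord_max))
    (fun i => nth 0 [:: X; Y; Z] i).

End Forms.

Section Connection.
Context {R : realType} {n : nat} {M : smoothManifold R n}.
Variable (D : connection M).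
Local Notation VF := (vfield M).
Local Notation C := (Cinf M).

Definition torsion : form2 VF := fun X Y => D X Y - D Y X - bracket X Y.

Lemma curvature_subproof (X Y : VF) :
  (fun Z => D X (D Y Z) - D Y (D X Z) - D (bracket X Y) Z) \in linear_endo M.
Proof.
apply/asboolP => f Z W; apply: vfieldP => p g.
rewrite !(nabla_addr, nabla_leibniz) !(vfieldDE, vfieldNE, vfieldZE) /=.
by ring.
Qed.

Definition curvature : form2 (endo M) := fun X Y =>
  MkEndo (curvature_subproof X Y).

Lemma nabla_end_subproof (X : VF) (E : endo M) :
  (fun W => D X (E W) - E (D X W)) \in linear_endo M.
Proof.
apply/asboolP => f Z W; apply: vfieldP => p g.
rewrite !(nabla_addr, nabla_leibniz, endoD, endoZ) !(vfieldDE, vfieldNE, vfieldZE).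
by ring.
Qed.

Definition nabla_end (X : VF) (E : endo M) : endo M :=
  MkEndo (nabla_end_subproof X E).

Definition nabla_form (X : VF) (theta : oneform M) : form1 C :=
  fun Y => vact X (theta Y) - theta (D X Y).

Definition dnabla_T : form3 VF := ext_dnabla2 D torsion.
Definition dnabla_R : form3 (endo M) := ext_dnabla2 nabla_end curvature.

Definition R_wedge_I : form3 VF := cyclic (fun X Y Z => curvature X Y Z).

Variables (theta : oneform M) (W : VF).

Definition T_theta : form2 C := fun X Y => theta (torsion X Y).
Definition Xi_theta : form2 C := fun X Y =>
  nabla_form Y theta X - nabla_form X theta Y.
Definition R_theta_W : form2 C := fun X Y => theta (curvature X Y W).
Definition omega_theta_W : form1 C := fun X => theta (D X W).
Definition Psi_theta_W : form2 C := fun X Y =>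
  nabla_form Y theta (D X W) - nabla_form X theta (D Y W).
Definition R_theta : form3 C := cyclic (fun X Y Z => theta (curvature X Y Z)).
Definition nabla_theta_wedge_T : form3 C :=
  cyclic (fun X Y Z => nabla_form X theta (torsion Y Z)).
Definition nabla_theta_wedge_R_W : form3 C :=
  cyclic (fun X Y Z => nabla_form X theta (curvature Y Z W)).
Definition R_theta_wedge_nabla_W : form3 C :=
  cyclic (fun X Y Z => theta (curvature Y Z (D X W))).

End Connection.

(* Main.v *)
(* Contracting with theta, theta (nabla_X V) = X (theta V) - (nabla_X theta) V, so
   theta (d^nabla T) = d T_theta - nabla theta /\ T, and likewise for the
   curvature.  Computing d Xi_theta and d Psi_theta_W directly uses no Jacobi
   identity: it enters only through d d = 0, applied to the structure equations.
   One-forms separate vector fields because the differentials df do, a vector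
   field being a family of derivations; hence the contracted identities give
   the Bianchi identities. *)
Require Import Defs.
From HB Require Import structures.
From mathcomp Require Import all_boot all_order all_algebra.
From mathcomp Require Import all_classical all_reals topology normedtype derive.
From mathcomp Require Import ring.
Import GRing.Theory.
Local Open Scope classical_set_scope.
Local Open Scope ring_scope.

(** * Sign and additivity rules for fields, forms and the connection; Jacobi identity *)

Section Additivity.
Context {R : realType} {n : nat} {M : smoothManifold R n}.
Implicit Types (X Y Z W : vfield M) (f g : Cinf M) (theta : oneform M).

Lemma vactB X f g : vact X (f - g) = vact X f - vact X g.
Proof. by apply: CinfP => p; exact: tangentB. Qed.

Lemma vactD X f g : vact X (f + g) = vact X f + vact X g.
Proof. by apply: CinfP => p; rewrite -[f in LHS]scale1r /= tangentL mul1r. Qed.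

Lemma vactN X f : vact X (- f) = - vact X f.
Proof. by rewrite -[in LHS]sub0r vactB -(subrr 0) vactB !subrr sub0r. Qed.

Lemma vact_bracket X Y f :
  vact (bracket X Y) f = vact X (vact Y f) - vact Y (vact X f).
Proof. exact: CinfP. Qed.

Lemma bracketC X Y : bracket X Y = - bracket Y X.
Proof. by apply: vfieldP => p f; rewrite vfieldNE /= opprB. Qed.

Lemma bracket_jacobi X Y Z :
  bracket (bracket X Y) Z + bracket (bracket Y Z) X + bracket (bracket Z X) Y = 0.
Proof.
apply: vfieldP => p f.
(* Lifted from values at [p] to [Cinf M], where brackets unfold as commutators: the twelve triple
   derivatives of [f] cancel in pairs. *)
suff: vact (bracket (bracket X Y) Z) f + vact (bracket (bracket Y Z) X) f +
      vact (bracket (bracket Z X) Y) f = 0 by move/(congr1 (fun g : Cinf M => g p)).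
by rewrite !(vact_bracket, vactB); ring.
Qed.

Lemma bracketNl X Y : bracket (- X) Y = - bracket X Y.
Proof.
apply: vfieldP => p f.
suff: vact (bracket (- X) Y) f = - vact (bracket X Y) f
  by move/(congr1 (fun g : Cinf M => g p)).
have vactNl g : vact (- X) g = - vact X g by exact: CinfP.
by rewrite !vact_bracket !vactNl vactN; ring.
Qed.

Lemma oneformD theta X Y : theta (X + Y) = theta X + theta Y.
Proof. by apply: CinfP => p; exact: linearD. Qed.

Lemma oneformN theta X : theta (- X) = - theta X.
Proof. by apply: CinfP => p; exact: linearN. Qed.

Lemma oneform0 theta : theta 0 = 0.
Proof. by apply: CinfP => p; exact: linear0. Qed.

Lemma endo_addE (E F : endo M) X : (E + F) X = E X + F X.
Proof. by []. Qed.

Lemma endo_oppE (E : endo M) X : (- E) X = - E X.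
Proof. by []. Qed.

Variable D : connection M.

Lemma nablaN X Y : D X (- Y) = - D X Y.
Proof.
have D0 : D X 0 = 0 by apply: (addrI (D X 0)); rewrite -nabla_addr !addr0.
by apply: (addrI (D X Y)); rewrite -nabla_addr !subrr.
Qed.

Lemma nabla_addl X X' Y : D (X + X') Y = D X Y + D X' Y.
Proof. by rewrite -[X in LHS]scale1r nabla_linearl scale1r. Qed.

Lemma nabla_oppl X Y : D (- X) Y = - D X Y.
Proof.
have D0 : D 0 Y = 0 by apply: (addrI (D 0 Y)); rewrite -nabla_addl !addr0.
by apply: (addrI (D X Y)); rewrite -nabla_addl !subrr.
Qed.

End Additivity.

(** * Differentials of functions as one-forms *)

Section ExactForm.
Context {R : realType} {n : nat} {M : smoothManifold R n}.

Definition differential_at (f : Cinf M) (p : M) (v : tangent p) : R^o := v f.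

Lemma differential_at_linear (f : Cinf M) (p : M) :
  linear (@differential_at f p).
Proof. by []. Qed.

HB.instance Definition _ (f : Cinf M) (p : M) :=
  GRing.isLinear.Build R (tangent p) R^o _ (@differential_at f p)
    (@differential_at_linear f p).

(** Since df(X) = X f, smoothness of df is part of what makes X a smooth field. *)
Definition differential (f : Cinf M) : oneform M :=
  @MkOneform R n M (fun p => @differential_at f p)
    (fun X => Cinf_smooth (vact X f)).

Lemma oneform_separates (X Y : vfield M) :
  (forall theta : oneform M, theta X = theta Y) -> X = Y.
Proof.
move=> XY; apply: vfieldP => p f.
exact: (congr1 (fun g : Cinf M => g p) (XY (differential f))).
Qed.

End ExactForm.

(** * d d = 0, and the cyclic form of the exterior covariant derivative *)

Section ExteriorDerivative.
Context {R : realType} {n : nat} {M : smoothManifold R n}.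

Lemma ext_d2D (a b : form2 (Cinf M)) : ext_d2 (a + b) = ext_d2 a + ext_d2 b.
Proof.
apply/funext => X; apply/funext => Y; apply/funext => Z.
by rewrite /ext_d2 /cyclic !fctE !vactD; ring.
Qed.

(** Second derivatives cancel against the expanded brackets, leaving the cyclic sum of
    omega([[X,Y],Z]); additivity makes it omega of the Jacobi sum. *)
Lemma ext_d2_d1 (omega : form1 (Cinf M)) :
  (forall X Y, omega (X + Y) = omega X + omega Y) -> ext_d2 (ext_d1 omega) = 0.
Proof.
move=> omegaD; apply/funext => X; apply/funext => Y; apply/funext => Z.
have omega0 : omega 0 = 0.
  by apply: (addrI (omega 0)); rewrite -omegaD !addr0.
have := congr1 omega (bracket_jacobi X Y Z); rewrite !omegaD omega0 => J.
rewrite /ext_d2 /cyclic /ext_d1 !vactB !vact_bracket.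
by rewrite -[RHS]J; ring.
Qed.

Lemma ext_dnabla2_cyclic (E : zmodType) (act : vfield M -> E -> E) (A : form2 E) :
    (forall X, {morph act X : e / - e}) ->
    (forall X Y, A X Y = - A Y X) -> (forall X Y, A (- X) Y = - A X Y) ->
  ext_dnabla2 act A = cyclic (fun X Y Z => act X (A Y Z) - A (bracket X Y) Z).
Proof.
move=> actN AC AN; apply/funext => X; apply/funext => Y; apply/funext => Z.
(* In this form the second argument of [A] meets [liftK], which resolves the [unlift]. *)
have max1 : ord_max = lift ord0 ord0 :> 'I_2 by exact: val_inj.
rewrite /ext_dnabla2 /ext_dnabla /cyclic !big_ord_recl !big_ord0 max1.
(* One pass for each inner sum, j = 0, 1, 2. *)
do 3!rewrite big_mkcond !big_ord_recl big_ord0.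
rewrite unlift_none !liftK /= /bump /= !addr0 !add0r.
(* The two terms out of cyclic order are - act Y (A X Z) and + A [X,Z] Y. *)
rewrite (AC X Z) actN (bracketC X Z) AN.
rewrite !(addn0, add0n, add1n, addn1) !exprS !expr0 !mulr1 !mulN1r !opprK.
rewrite !(mulr1z, mulrN1z) !opprK.
rewrite [in RHS](addrACA (act X _)) [in RHS](addrACA (act X _ + _)).
by rewrite (addrC (- A (bracket Z X) Y)) !addrA.
Qed.

End ExteriorDerivative.

(** * Structure equations, their exterior derivatives, and contracted Bianchi identities *)

Section StructureEquations.
Context {R : realType} {n : nat} {M : smoothManifold R n}.
Variables (D : connection M) (theta : oneform M).
Implicit Types X Y Z W : vfield M.

Lemma torsionC X Y : torsion D X Y = - torsion D Y X.
Proof. by rewrite /torsion (bracketC X Y) opprK !opprB addrC. Qed.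

Lemma torsionNl X Y : torsion D (- X) Y = - torsion D X Y.
Proof. by rewrite /torsion nabla_oppl nablaN bracketNl !opprD. Qed.

Lemma curvatureC X Y : curvature D X Y = - curvature D Y X.
Proof.
apply: endo_inj => W; rewrite endo_oppE /curvature /= (bracketC X Y).
by rewrite nabla_oppl opprK !opprB addrC.
Qed.

Lemma curvatureNl X Y : curvature D (- X) Y = - curvature D X Y.
Proof.
apply: endo_inj => W; rewrite endo_oppE /curvature /=.
by rewrite bracketNl !nabla_oppl nablaN !opprD.
Qed.

Lemma nabla_endN X : {morph nabla_end D X : E / - E}.
Proof.
move=> E; apply: endo_inj => W.
by rewrite endo_oppE /nabla_end /= nablaN opprD.
Qed.

Lemma T_theta_structure : T_theta D theta = ext_d1 theta + Xi_theta D theta.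
Proof.
apply/funext => X; apply/funext => Y; rewrite !fctE.
rewrite /T_theta /ext_d1 /Xi_theta /nabla_form /torsion.
by rewrite !(oneformD, oneformN); ring.
Qed.

(** Split theta(D_X D_Y W) as X(omega(Y)) - (nabla_X theta)(D_Y W): the first terms build d omega,
    the others Psi. *)
Lemma R_theta_W_structure W :
  R_theta_W D theta W = ext_d1 (omega_theta_W D theta W) + Psi_theta_W D theta W.
Proof.
apply/funext => X; apply/funext => Y; rewrite !fctE.
rewrite /R_theta_W /ext_d1 /Psi_theta_W /omega_theta_W /nabla_form /=.
by rewrite !(oneformD, oneformN); ring.
Qed.

Lemma ext_d2_T_theta : ext_d2 (T_theta D theta) = ext_d2 (Xi_theta D theta).
Proof.
by rewrite T_theta_structure ext_d2D ext_d2_d1 ?add0r //; exact: oneformD.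
Qed.

Lemma ext_d2_R_theta_W W :
  ext_d2 (R_theta_W D theta W) = ext_d2 (Psi_theta_W D theta W).
Proof.
rewrite R_theta_W_structure ext_d2D ext_d2_d1 ?add0r // => X Y.
by rewrite /omega_theta_W nabla_addl oneformD.
Qed.

(** On the right, the terms theta(D_X D_Y Z) from curvature cancel cyclically those from theta(D_X
    T(Y,Z)); on the left, the second derivatives of theta(Z) cancel against [X,Y] theta(Z). *)
Lemma ext_d2_Xi_theta :
  ext_d2 (Xi_theta D theta) = R_theta D theta + nabla_theta_wedge_T D theta.
Proof.
apply/funext => X; apply/funext => Y; apply/funext => Z; rewrite !fctE.
rewrite /ext_d2 /Xi_theta /R_theta /nabla_theta_wedge_T /cyclic /nabla_form /torsion /=.
rewrite !(nabla_addr, nablaN, oneformD, oneformN).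
by rewrite !(vactB, vactD, vactN, vact_bracket); ring.
Qed.

(** Likewise, the triple covariant derivatives of [W] cancel between the two wedge terms. *)
Lemma ext_d2_Psi_theta_W W :
  ext_d2 (Psi_theta_W D theta W) =
    nabla_theta_wedge_R_W D theta W + R_theta_wedge_nabla_W D theta W.
Proof.
apply/funext => X; apply/funext => Y; apply/funext => Z; rewrite !fctE.
rewrite /ext_d2 /Psi_theta_W /nabla_theta_wedge_R_W /R_theta_wedge_nabla_W.
rewrite /cyclic /nabla_form /=.
rewrite !(nabla_addr, nablaN, oneformD, oneformN).
by rewrite !(vactB, vactD, vactN, vact_bracket); ring.
Qed.

Lemma oneform_dnabla_T X Y Z :
  theta (dnabla_T D X Y Z) =
    ext_d2 (T_theta D theta) X Y Z - nabla_theta_wedge_T D theta X Y Z.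
Proof.
rewrite /dnabla_T ext_dnabla2_cyclic;
  [|exact: nablaN|exact: torsionC|exact: torsionNl].
rewrite /ext_d2 /T_theta /nabla_theta_wedge_T /cyclic /nabla_form.
by rewrite !(oneformD, oneformN); ring.
Qed.

(** In (nabla_X R(Y,Z)) W = D_X (R(Y,Z) W) - R(Y,Z) D_X W, the first term yields d R_theta_W and
    nabla theta /\ R_W, the second R_theta /\ nabla W. *)
Lemma oneform_dnabla_R X Y Z W :
  theta (dnabla_R D X Y Z W) =
    ext_d2 (R_theta_W D theta W) X Y Z
    - (nabla_theta_wedge_R_W D theta W + R_theta_wedge_nabla_W D theta W) X Y Z.
Proof.
rewrite /dnabla_R ext_dnabla2_cyclic;
  [|exact: nabla_endN|exact: curvatureC|exact: curvatureNl].
rewrite /cyclic !endo_addE !endo_oppE /nabla_end /=.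
rewrite /ext_d2 /R_theta_W /nabla_theta_wedge_R_W /R_theta_wedge_nabla_W.
rewrite !fctE /cyclic /nabla_form /=.
by rewrite !(oneformD, oneformN); ring.
Qed.

Lemma oneform_R_wedge_I X Y Z : theta (R_wedge_I D X Y Z) = R_theta D theta X Y Z.
Proof. by rewrite /R_wedge_I /R_theta /cyclic !oneformD. Qed.

End StructureEquations.

Theorem proposition3p6 (R : realType) (n : nat) (M : smoothManifold R n)
    (Mconn : connected [set: M]) (D : connection M) :
  (forall (theta : oneform M) (X Y Z : vfield M),
     theta (dnabla_T D X Y Z) =
     R_theta D theta X Y Z + ext_d2 (T_theta D theta - Xi_theta D theta) X Y Z) /\
  (forall (theta : oneform M) (X Y Z W : vfield M),
     theta (dnabla_R D X Y Z W) =
     ext_d2 (R_theta_W D theta W - Psi_theta_W D theta W) X Y Z) /\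
  (dnabla_T D = R_wedge_I D <->
   forall theta : oneform M,
     ext_d2 (T_theta D theta) = ext_d2 (Xi_theta D theta) /\
     ext_d2 (Xi_theta D theta) = R_theta D theta + nabla_theta_wedge_T D theta) /\
  (dnabla_R D = 0 <->
   forall (theta : oneform M) (W : vfield M),
     ext_d2 (R_theta_W D theta W) = ext_d2 (Psi_theta_W D theta W) /\
     ext_d2 (Psi_theta_W D theta W) =
       nabla_theta_wedge_R_W D theta W + R_theta_wedge_nabla_W D theta W) /\
  (forall theta : oneform M,
     T_theta D theta = ext_d1 theta + Xi_theta D theta /\
     ext_d2 (T_theta D theta) = ext_d2 (Xi_theta D theta)) /\
  (forall (theta : oneform M) (W : vfield M),
     R_theta_W D theta W = ext_d1 (omega_theta_W D theta W) + Psi_theta_W D theta W /\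
     ext_d2 (R_theta_W D theta W) = ext_d2 (Psi_theta_W D theta W)) /\
  dnabla_T D = R_wedge_I D /\
  dnabla_R D = 0.
Proof.
have fun3_ext (E : Type) (F G : form3 E) : (forall X Y Z, F X Y Z = G X Y Z) -> F = G.
  move=> FG; apply/funext => X; apply/funext => Y; apply/funext => Z; exact: FG.
have bianchi1 : dnabla_T D = R_wedge_I D <->
    forall theta : oneform M,
      ext_d2 (T_theta D theta) = ext_d2 (Xi_theta D theta) /\
      ext_d2 (Xi_theta D theta) = R_theta D theta + nabla_theta_wedge_T D theta.
  split=> [dT theta|dT].
    split; first exact: ext_d2_T_theta.
    rewrite -ext_d2_T_theta; apply: fun3_ext => X Y Z.
    (* R_theta is theta of R /\ I, which [dT] turns into d T_theta - nabla theta /\ T. *)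
    by rewrite !fctE -oneform_R_wedge_I -dT oneform_dnabla_T subrK.
  apply: fun3_ext => X Y Z; apply: oneform_separates => theta.
  have [dTX dX] := dT theta.
  by rewrite oneform_dnabla_T oneform_R_wedge_I dTX dX !fctE addrK.
have bianchi2 : dnabla_R D = 0 <->
    forall (theta : oneform M) (W : vfield M),
      ext_d2 (R_theta_W D theta W) = ext_d2 (Psi_theta_W D theta W) /\
      ext_d2 (Psi_theta_W D theta W) =
        nabla_theta_wedge_R_W D theta W + R_theta_wedge_nabla_W D theta W.
  split=> [dR theta W|dR].
    split; first exact: ext_d2_R_theta_W.
    rewrite -ext_d2_R_theta_W; apply: fun3_ext => X Y Z.
    by apply/eqP; rewrite -subr_eq0 -oneform_dnabla_R dR oneform0.
  apply: fun3_ext => X Y Z; apply: endo_inj => W.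
  apply: oneform_separates => theta; have [dRP dP] := dR theta W.
  by rewrite oneform_dnabla_R dRP dP subrr oneform0.
have dT_theta theta := ext_d2_T_theta D theta.
have dR_theta theta W := ext_d2_R_theta_W D theta W.
have first_bianchi : dnabla_T D = R_wedge_I D.
  by apply/bianchi1 => theta; split; [exact: dT_theta|exact: ext_d2_Xi_theta].
have second_bianchi : dnabla_R D = 0.
  by apply/bianchi2 => theta W; split; [exact: dR_theta|exact: ext_d2_Psi_theta_W].
split=> [theta X Y Z|].
  (* The difference is exact, so its d vanishes and the contracted first Bianchi identity
     remains. *)
  have -> : T_theta D theta - Xi_theta D theta = ext_d1 theta.
    by rewrite T_theta_structure addrK.
  rewrite ext_d2_d1; last exact: oneformD.
  by rewrite addr0 first_bianchi oneform_R_wedge_I.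
split=> [theta X Y Z W|].
  have -> : R_theta_W D theta W - Psi_theta_W D theta W =
            ext_d1 (omega_theta_W D theta W).
    by rewrite R_theta_W_structure addrK.
  rewrite ext_d2_d1 ?second_bianchi ?oneform0 // => A B.
  by rewrite /omega_theta_W nabla_addl oneformD.
split=> //; split=> //.
split=> [theta|]; first by split; [exact: T_theta_structure|exact: dT_theta].
split=> // theta W; split; [exact: R_theta_W_structure|exact: dR_theta].
Qed.
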